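(* For each $n$ let $a=a_n\in[0,\infty)$ and let $\mu_{a}$ be the normalized Lebesgue measure on the simplex $$\Delta_n(a)=\{(x_0,\dots,x_{n-1}): 0\leqslant x_0\leqslant x_1\leqslant\dots\leqslant x_{n-1}\leqslant a\}.$$ (1) Let $\lambda>0$ be a constant and suppose $a=\lambda n+o(n)$ as $n\to\infty$. Then for every fixed positive integer $k$, the distribution of $(x_0,\dots,x_{k-1})$ under $\mu_a$ converges weakly, as $n\to\infty$, to the law of the first $k$ positions of the exponential random walk with mean $\lambda$, that is, to the law under which $x_0,\ x_1-x_0,\ \dots,\ x_{k-1}-x_{k-2}$ are independent and identically distributed with density $\lambda^{-1}e^{-t/\lambda}$ on $(0,\infty)$. (2) If $a=o(n)$ as $n\to\infty$, then for every fixed positive integer $k$ the distribution of $(x_0,\dots,x_{k-1})$ under $\mu_a$ converges weakly to the $\delta$-measure at $(0,\dots,0)$. (3) If $a/n\to\infty$ as $n\to\infty$, then for every fixed positive integer $k$ the distribution of $(x_0,\dots,x_{k-1})$ under $\mu_a$ converges to the zero measure, in the sense that $\int f(x_0,\dots,x_{k-1})\,d\mu_a\to 0$ for every compactly supported continuous function $f$ on $\mathbb R^k$.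
   Context: The set $\Delta_n(a)$ is the set of paths from level $0$ to the vertex $a$ of level $n$ in the one-dimensional Gelfand--Tsetlin graph (Cesàro graph), whose level-$n$ vertex set is $[0,\infty)$ for every $n\ge0$ and in which a vertex $x$ of level $n$ is joined to a vertex $y$ of level $n+1$ iff $x\leqslant y$. For $a=0$ the simplex is a single point and $\mu_0$ is the $\delta$-measure at it. For fixed $k$ only $n\ge k$ is considered. *)

(* Defs.v *)
From HB Require Import structures.
From mathcomp Require Import all_boot all_order all_algebra.
From mathcomp Require Import all_classical all_reals all_analysis.

Set Implicit Arguments.
Unset Strict Implicit.
Unset Printing Implicit Defensive.

Import Order.TTheory GRing.Theory Num.Theory.
Import numFieldNormedType.Exports.

Local Open Scope classical_set_scope.
Local Open Scope ring_scope.

Section power_measure.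
Context d (T : measurableType d) (R : realType).

Definition tcons n (p : T * n.-tuple T) : n.+1.-tuple T :=
  [tuple of p.1 :: p.2].

Lemma measurable_tcons n : measurable_fun setT (@tcons n).
Proof. exact: measurable_cons. Qed.

Definition mcons (m : set T -> \bar R) n (mu : set (n.-tuple T) -> \bar R) :
  set (n.+1.-tuple T) -> \bar R := pushforward (m \x mu)%E (@tcons n).

(* The n-fold product measure m \x ... \x m; on the one-point space
   0.-tuple T it is the unit mass. *)
Fixpoint mpower (m : set T -> \bar R) (n : nat) : set (n.-tuple T) -> \bar R :=
  match n with
  | 0 => \d_([tuple] : 0.-tuple T)
  | k.+1 => mcons m (@mpower m k)
  end.

Section mcons_sigma_finite.
Variables (m : {sigma_finite_measure set T -> \bar R}) (n : nat).
Variable mu : {sigma_finite_measure set (n.-tuple T) -> \bar R}.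

Let M : {measure set (n.+1.-tuple T) -> \bar R} :=
  measure_function_pushforward__canonical__measure_function_Measure
    (m \x mu)%E (@measurable_tcons n).

HB.instance Definition _ := Measure.copy (mcons m mu) M.

Lemma mcons_box (A : set T) (B : set (n.-tuple T)) :
  measurable A -> measurable B ->
  mcons m mu [set x | A (thead x) /\ B [tuple of behead x]] = (m A * mu B)%E.
Proof.
move=> mA mB; rewrite -product_measure1E//.
rewrite /mcons /pushforward; congr ((_ \x _)%E _).
apply/seteqP; split => -[x t] /=; rewrite theadE.
- by move=> [Ax Bt]; split => //=; rewrite (_ : t = [tuple of behead (x :: t)])//; apply/val_inj.
- by move=> [Ax Bt]; split => //=; rewrite (_ : [tuple of behead (x :: t)] = t)//; apply/val_inj.
Qed.

Let mcons_sigma_finite : sigma_finite setT (mcons m mu).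
Proof.
have /sigma_finiteP[F [TF ndF Foo]] := sigma_finiteT m.
have /sigma_finiteP[G [TG ndG Goo]] := sigma_finiteT mu.
exists (fun i => [set x | F i (thead x) /\ G i [tuple of behead x]]).
  apply/seteqP; split => // x _.
  have : setT (thead x) by [].
  have : setT [tuple of behead x] by [].
  rewrite TF TG => -[j _ Gj] [i _ Fi]; exists (maxn i j) => //; split.
  - by move: Fi; exact/subsetPset/ndF/leq_maxl.
  - by move: Gj; exact/subsetPset/ndG/leq_maxr.
move=> i; have [mFi Fi] := Foo i; have [mGi Gi] := Goo i; split.
  apply: measurableI.
    by rewrite -[X in measurable X]setTI; exact: measurable_tnth.
  by rewrite -[X in measurable X]setTI; exact: measurable_behead.
by rewrite mcons_box// lte_mul_pinfty// ge0_fin_numE.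
Qed.

HB.instance Definition _ := Measure_isSigmaFinite.Build _ _ _ (mcons m mu)
  mcons_sigma_finite.

End mcons_sigma_finite.

Section mpower_sigma_finite.
Variable m : {sigma_finite_measure set T -> \bar R}.

Lemma mpower_ex n :
  exists mu : {sigma_finite_measure set (n.-tuple T) -> \bar R},
    @mpower m n = mu.
Proof.
elim: n => [|n [mu IH]]/=; first by eexists (\d_ _).
by exists (mcons m mu); rewrite IH.
Qed.

Variable n : nat.
Notation mpow := (@mpower m n).

Let mpower0 : mpow set0 = 0%E.
Proof. by have [mu ->] := mpower_ex n; rewrite measure0. Qed.

Let mpower_ge0 A : (0 <= mpow A)%E.
Proof. by have [mu ->] := mpower_ex n. Qed.

Let mpower_sigma_additive : semi_sigma_additive mpow.
Proof. by have [mu ->] := mpower_ex n; exact: measure_semi_sigma_additive. Qed.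

HB.instance Definition _ := isMeasure.Build _ _ _ mpow
  mpower0 mpower_ge0 mpower_sigma_additive.

Let mpower_sigma_finite : sigma_finite setT mpow.
Proof. by have [mu ->] := mpower_ex n; exact: sigma_finiteT. Qed.

HB.instance Definition _ := Measure_isSigmaFinite.Build _ _ _ mpow
  mpower_sigma_finite.

End mpower_sigma_finite.
End power_measure.
Arguments mpower {d T R} m n.

Section simplex.
Context {R : realType}.

(* R with the measurable structure that carries [lebesgue_measure]. *)
Local Notation RM := (measurableTypeR R).

(* The chain 0 <= x_0 <= ... <= x_{n-1} <= a. *)
Definition simplex (n : nat) (a : R) : set (n.-tuple RM) :=
  [set x | path <=%R 0 (rcons x a)].
Arguments simplex n a : clear implicits.

Lemma measurable_nth n (c : R) i :
  measurable_fun setT (fun x : n.-tuple RM => nth c x i).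
Proof.
case: (ltnP i n) => [lin|nli].
  rewrite (_ : (fun _ => _) = (@tnth n RM ^~ (Ordinal lin))).
    exact: measurable_tnth.
  by apply/funext => x; rewrite (tnth_nth c).
rewrite (_ : (fun _ => _) = cst c); first exact: measurable_cst.
by apply/funext => x; rewrite nth_default// size_tuple.
Qed.

Lemma measurable_simplex n a : measurable (simplex n a).
Proof.
have mnth i : measurable_fun setT
    (fun x : n.-tuple RM => nth 0 (rcons x a) i).
  have [->|lin] := eqVneq i n.
    rewrite (_ : (fun _ => _) = cst a); first exact: measurable_cst.
    by apply/funext => x; rewrite nth_rcons size_tuple ltnn eqxx.
  rewrite (_ : (fun _ => _) = (fun x : n.-tuple RM => nth 0 x i)).
    exact: measurable_nth.
  apply/funext => x; rewrite nth_rcons size_tuple (negbTE lin).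
  by case: ltnP => // ?; rewrite nth_default// size_tuple.
rewrite (_ : simplex n a = \bigcap_(i in [set i | (i < n.+1)%N])
    [set x | nth 0 (0 :: rcons x a) i <= nth 0 (rcons x a) i]); last first.
  apply/seteqP; split => x /=.
    by move=> /(pathP 0) + i /= ilt; apply; rewrite size_rcons size_tuple.
  by move=> H; apply/(pathP 0) => i; rewrite size_rcons size_tuple; exact: H.
apply: bigcap_measurable; first by exists 0%N.
move=> i _; rewrite -[X in measurable X]setTI.
apply: measurable_fun_le => //; case: i => [|i] /=; last exact: mnth.
exact: measurable_cst.
Qed.

Definition zero_tuple (n : nat) : n.-tuple RM := [tuple 0 | i < n].

(* For 0 <= a, the Lebesgue mass a ^+ n / n`! of the simplex is finite, and it
   vanishes exactly when a = 0 < n; [mnormalize] then returns its second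
   argument, the unit mass at the only point of the simplex. *)
Definition simplex_prob (n : nat) (a : R) : probability (n.-tuple RM) R :=
  mnormalize (mrestr (mpower lebesgue_measure n) (@measurable_simplex n a))
    (\d_(zero_tuple n)).

(* Only meaningful for k <= n: missing coordinates are filled with 0. *)
Definition first_coords (n k : nat) (x : n.-tuple RM) : k.-tuple RM :=
  [tuple nth 0 x i | i < k].

(* The distribution of (x_0, ..., x_{k-1}) under [simplex_prob n a]. *)
Definition simplex_law (n k : nat) (a : R) : set (k.-tuple RM) -> \bar R :=
  pushforward (simplex_prob n a) (@first_coords n k).

Definition partial_sums (k : nat) (t : k.-tuple RM) : k.-tuple RM :=
  [tuple \sum_(j < k | (j <= i)%N) tnth t j | i < k].

(* [exponential_prob] is parametrised by the rate, the inverse of the mean. *)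
Definition exp_walk_law (lambda : R) (k : nat) : set (k.-tuple RM) -> \bar R :=
  pushforward (mpower (exponential_prob lambda^-1) k) (@partial_sums k).

(* Tuples carry the product sigma-algebra but no topology, row vectors the
   product topology; [row_of] identifies the two models of R^k. *)
Definition row_of (k : nat) (t : k.-tuple RM) : 'rV[R]_k := \row_i tnth t i.

Definition weak_cvg (k : nat) (mu : nat -> set (k.-tuple RM) -> \bar R)
    (nu : set (k.-tuple RM) -> \bar R) : Prop :=
  forall f : 'rV[R]_k -> R, continuous f -> bounded_fun f ->
    (\int[mu n]_x (f (row_of x))%:E)%E @[n --> \oo] -->
    (\int[nu]_x (f (row_of x))%:E)%E.

Definition compactly_supported (k : nat) (f : 'rV[R]_k -> R) : Prop :=
  compact (closure [set x | f x != 0]).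

Definition vague_cvg0 (k : nat) (mu : nat -> set (k.-tuple RM) -> \bar R) :
    Prop :=
  forall f : 'rV[R]_k -> R, continuous f -> compactly_supported f ->
    (\int[mu n]_x (f (row_of x))%:E)%E @[n --> \oo] --> 0%E.

End simplex.
Arguments simplex {R} n a.
Arguments zero_tuple {R} n.
Arguments simplex_prob {R} n a.
Arguments simplex_law {R} n k a.
Arguments exp_walk_law {R} lambda k.

(* Main.v *)
Require Import Defs.
From HB Require Import structures.
From mathcomp Require Import all_boot all_order all_algebra.
From mathcomp Require Import all_classical all_reals all_analysis.
From mathcomp Require Import measurable_realfun ring lra.

Import Order.TTheory GRing.Theory Num.Theory.
Import numFieldNormedType.Exports.

Local Open Scope classical_set_scope.
Local Open Scope ring_scope.

Set Implicit Arguments.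
Unset Strict Implicit.
Unset Printing Implicit Defensive.

(** Write [c = a / n] and suppose [a > 0]; when [a = 0] the law is the unit mass
at the origin, and the integral formula below still holds.  A point of the simplex is determined by its increments, and
dividing them by [c] turns the simplex of side [a] into the simplex of side
[n].  In these coordinates the marginal law of the first [k] points has, with
respect to Lebesgue measure on the increments [t_0, ..., t_(k-1) >= 0], the
density [n ^_ k / n ^ k * (1 - S / n) ^ (n - k)] on [S <= n], where [S] is the
sum of the increments; the last factor is, up to a constant, the volume of the
simplex that is left to the other [n - k] points.

Take as reference measure the [k]-th power [P] of the exponential law of
mean 1.  Then the density becomes
[simplex_density n k S = n ^_ k / n ^ k * (1 - S / n) ^ (n - k) * e ^ S].  It
tends to 1 for every [S] ([simplex_density_cvg]), and it is bounded by [e ^ k]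
uniformly in [n] and [S] ([simplex_density_le]), because
[1 - S / n <= e ^ (- S / n)] and [S <= n].  Since moreover ([integral_simplex_law])
the integral of [f] under the law of the first [k] points is the [P]-integral of
[f (c * s) * simplex_density n k S], where [s] is the vector of partial sums of
[t], a single dominated convergence with a constant bound ([simplex_law_cvg])
reduces the three claims to the pointwise limit of [f (c_n * s)]:
- if [c_n] tends to [lambda], it is [f (lambda * s)], and [lambda * s] is
  distributed as the exponential walk of mean [lambda]
  ([integral_exp_walk_law]);
- if [c_n] tends to 0, it is [f 0];
- if [c_n] tends to infinity and [f] has compact support, it is 0 as soon as
  [t_0] is nonzero, which is [P]-almost sure.

The formula for the law is [ge0_integral_chain], an induction on [k] that
integrates out the lowest point by Fubini; its base case is the volume of the
simplex, [integral_path]. *)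

(** * Integrals over finite powers of a measure *)

Lemma ge0_integral_pushforwardT d d' (X : measurableType d)
    (Y : measurableType d') (R : realType) (m : {measure set X -> \bar R})
    (phi : X -> Y) (h : Y -> \bar R) :
  measurable_fun setT phi -> (forall y, 0 <= h y)%E -> measurable_fun setT h ->
  (\int[pushforward m phi]_y h y = \int[m]_x h (phi x))%E.
Proof.
move=> mphi h0 mh.
have := @ge0_integral_pushforward _ _ _ _ R phi mphi m setT h.
by rewrite preimage_setT; apply.
Qed.

Section mpower_integral.
Local Open Scope ereal_scope.
Context d (T : measurableType d) (R : realType).
Variable m : {sigma_finite_measure set T -> \bar R}.
Implicit Types n : nat.

Lemma ge0_integral_mpower0 (h : 0.-tuple T -> \bar R) :
  (forall x, 0 <= h x) -> measurable_fun setT h ->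
  \int[mpower m 0]_x h x = h [tuple].
Proof. by move=> h0 mh; rewrite integral_dirac// diracT mul1e. Qed.

Lemma measurable_integral_tcons n (h : n.+1.-tuple T -> \bar R) :
  (forall x, 0 <= h x) -> measurable_fun setT h ->
  measurable_fun setT (fun x : T => \int[mpower m n]_t h (tcons (x, t))).
Proof.
move=> h0 mh.
apply: (@measurable_fun_fubini_tonelli_F _ _ _ _ _
  (mpower m n) (fun p => h (tcons p))) => //.
by apply: measurableT_comp => //; exact: measurable_tcons.
Qed.

Lemma measurable_tconsr n (x : T) :
  measurable_fun setT (fun t : n.-tuple T => tcons (x, t)).
Proof.
by apply: (measurable_cons (f := fun=> x) (g := fun t : n.-tuple T => t)).
Qed.

Lemma ge0_integral_mpowerS n (h : n.+1.-tuple T -> \bar R) :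
  (forall x, 0 <= h x) -> measurable_fun setT h ->
  \int[mpower m n.+1]_x h x
  = \int[m]_x \int[mpower m n]_t h (tcons (x, t)).
Proof.
move=> h0 mh.
transitivity (\int[m \x mpower m n]_p h (tcons p)).
  exact: (@ge0_integral_pushforwardT _ _ _ _ R (m \x mpower m n) _ h
    (@measurable_tcons _ T n)).
rewrite (@fubini_tonelli1 _ _ _ _ _ m (mpower m n) (fun p => h (tcons p)))//.
by apply: measurableT_comp => //; exact: measurable_tcons.
Qed.

End mpower_integral.

Section mpower_map.
Local Open Scope ereal_scope.
Context {R : realType}.

Lemma measurable_map_tuple d (T : measurableType d) d' (U : measurableType d')
    (phi : U -> T) k :
  measurable_fun setT phi ->
  measurable_fun setT (fun t : k.-tuple U => map_tuple phi t).
Proof.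
move=> mphi; apply/measurable_fun_tnthP => i.
rewrite (_ : _ \o _ = phi \o (fun t => tnth t i)); last first.
  by apply/funext => t /=; rewrite tnth_map.
by apply: (measurableT_comp mphi); exact: measurable_tnth.
Qed.

(** A change of variables in one coordinate passes to every power, by
Fubini. *)
Lemma ge0_integral_mpower_map d (T : measurableType d) d'
    (U : measurableType d') (P : {sigma_finite_measure set T -> \bar R})
    (Q : {sigma_finite_measure set U -> \bar R}) (phi : U -> T) k
    (h : k.-tuple T -> \bar R) :
  measurable_fun setT phi ->
  (forall g : T -> \bar R, (forall x, 0 <= g x) -> measurable_fun setT g ->
    \int[P]_x g x = \int[Q]_u g (phi u)) ->
  (forall x, 0 <= h x) -> measurable_fun setT h ->
  \int[mpower P k]_t h t = \int[mpower Q k]_t h (map_tuple phi t).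
Proof.
move=> mphi PQ; elim: k h => [|k IH] h h0 mh.
  rewrite (ge0_integral_mpower0 P)// (ge0_integral_mpower0 Q)//.
    by congr h; exact/esym/tuple0.
  exact: (measurableT_comp mh (@measurable_map_tuple _ _ _ _ _ _ mphi)).
rewrite (ge0_integral_mpowerS P)// PQ; last 2 first.
- by move=> x; apply: integral_ge0.
- exact: measurable_integral_tcons.
rewrite (ge0_integral_mpowerS Q)//; last first.
  exact: (measurableT_comp mh (@measurable_map_tuple _ _ _ _ _ _ mphi)).
apply: eq_integral => s _; rewrite IH//; last first.
  exact: (measurableT_comp mh (@measurable_tconsr _ _ _ _)).
by apply: eq_integral => t _; congr h; exact/val_inj.
Qed.

End mpower_map.

Lemma mpower_prob_setT d (T : measurableType d) (R : realType)
  (P : probability T R) n : mpower P n setT = 1%E.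
Proof.
elim: n => [|n IH]; first by rewrite /= diracT.
have := mcons_box P (mpower P n) (@measurableT _ T) (@measurableT _ (n.-tuple T)).
rewrite [X in (X * _)%E](probability_setT P) [X in (_ * X)%E]IH mule1 => <- /=.
by congr (mcons _ _ _); apply/seteqP; split.
Qed.

HB.instance Definition _ d (T : measurableType d) (R : realType)
    (P : probability T R) n :=
  Measure_isProbability.Build _ _ _ (mpower P n) (mpower_prob_setT P n).

(** * One-dimensional changes of variables *)

Section density.
Local Open Scope ereal_scope.
Context {R : realType}.

(** Any such density is almost everywhere the Radon-Nikodym derivative, for
which the change of variables is known. *)
Lemma ge0_integral_density d (T : measurableType d)
    (nu : {finite_measure set T -> \bar R})
    (m : {sigma_finite_measure set T -> \bar R}) (p : T -> R) g :
  (forall x, 0 <= p x)%R -> measurable_fun setT p ->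
  (forall A, measurable A -> nu A = \int[m]_(x in A) (p x)%:E) ->
  (forall x, 0 <= g x) -> measurable_fun setT g ->
  \int[nu]_x g x = \int[m]_x (g x * (p x)%:E).
Proof.
move=> p0 mp nuE g0 mg.
have num : nu `<< m.
  apply/null_content_dominatesP => A mA A0.
  rewrite nuE//; apply: null_set_integral => //.
  by apply/measurable_funTS/measurable_EFinP.
rewrite -(Radon_Nikodym_SigmaFinite.change_of_variables num)//.
have iF := Radon_Nikodym_SigmaFinite.f_integrable num.
apply: ae_eq_integral => //.
- by apply: emeasurable_funM => //; exact: measurable_int iF.
- by apply: emeasurable_funM => //; exact/measurable_EFinP.
- apply: ae_eqe_mul2l; apply: integral_ae_eq => //.
    exact/measurable_EFinP.
  by move=> E _ mE; rewrite -Radon_Nikodym_SigmaFinite.f_integral// nuE.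
Qed.

(** Signed integrals are differences of integrals of non-negative functions,
so such a formula extends to every measurable function, integrable or not. *)
Lemma integral_of_ge0 d d' (X : measurableType d) (Y : measurableType d')
    (m : {measure set X -> \bar R}) (nu : {measure set Y -> \bar R})
    (phi : Y -> X) (w : Y -> R) : (forall y, 0 <= w y)%R ->
  (forall h : X -> \bar R, (forall x, 0 <= h x) -> measurable_fun setT h ->
    \int[m]_x h x = \int[nu]_y (h (phi y) * (w y)%:E)) ->
  forall f : X -> \bar R, measurable_fun setT f ->
  \int[m]_x f x = \int[nu]_y (f (phi y) * (w y)%:E).
Proof.
move=> w0 mE f mf; rewrite integralE [RHS]integralE.
rewrite mE//; last exact: measurable_funepos.
rewrite mE//; last exact: measurable_funeneg.
congr (_ - _); apply: eq_integral => y _.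
- by rewrite !funeposE maxe_pMl ?lee_fin// mul0e.
- by rewrite !funenegE maxe_pMl ?lee_fin// mul0e mulNe.
Qed.

End density.

Section one_dimension.
Local Open Scope ereal_scope.
Context {R : realType}.
Local Notation RM := (measurableTypeR R).
Local Notation mu := (@lebesgue_measure R).

Lemma measurable_affine (b c : R) :
  measurable_fun setT ((fun s => b + c * s)%R : RM -> RM).
Proof. by apply: measurable_funD => //; exact: measurable_funM. Qed.

(** Both sides are measures in [A] that agree on half-open intervals, and these
determine Lebesgue measure. *)
Lemma lebesgue_measure_affine (b c : R) (A : set RM) : (0 < c)%R ->
  measurable A ->
  mu A = c%:E * pushforward mu ((fun s => b + c * s)%R : RM -> RM) A.
Proof.
move=> c0 mA.
pose P : {measure set RM -> \bar R} :=
  measure_function_pushforward__canonical__measure_function_Measure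
    mu (measurable_affine b c).
pose S := mscale (NngNum (ltW c0)) P.
rewrite (lebesgue_measure_unique (mu := S))// => _ [[x y]] _ <- /=.
rewrite /S /P /mscale /= /pushforward /=.
rewrite (_ : _ @^-1` _ = `](x - b) / c, (y - b) / c]%classic)%R; last first.
  apply/seteqP; split=> z /=; rewrite !in_itv/= ltr_pdivrMr// ler_pdivlMr//
    (mulrC z) ltrBlDl lerBrDl//.
rewrite !lebesgue_measure_itv/= !lte_fin ltr_pM2r ?invr_gt0// ltrD2r.
case: ifP => _; last by rewrite mule0.
by rewrite -!EFinD -EFinM; congr EFin; field; rewrite gt_eqF.
Qed.

Lemma ge0_integral_affine (b c : R) (g : RM -> \bar R) : (0 < c)%R ->
  (forall x, 0 <= g x) -> measurable_fun setT g ->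
  \int[mu]_x g x = c%:E * \int[mu]_s g (b + c * s)%R.
Proof.
move=> c0 g0 mg.
pose P : {measure set RM -> \bar R} :=
  measure_function_pushforward__canonical__measure_function_Measure
    mu (measurable_affine b c).
transitivity (\int[mscale (NngNum (ltW c0)) P]_x g x).
  by apply: eq_measure_integral => A mA _; exact: lebesgue_measure_affine.
rewrite ge0_integral_mscale//=; congr (_ * _).
exact: (@ge0_integral_pushforwardT _ _ _ _ R mu _ g (measurable_affine b c)).
Qed.

(** Packaged with its positivity proof, which makes it a probability measure. *)
Definition exponential_law (r : R) (r0 : (0 < r)%R) : probability RM R :=
  exponential_distribution_exponential_prob__canonical__probability_measure_Probability r0.

Definition unit_exponential : probability RM R := exponential_law ltr01.

Lemma ge0_integral_exponential (r : R) (r0 : (0 < r)%R) (g : RM -> \bar R) :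
  (forall x, 0 <= g x) -> measurable_fun setT g ->
  \int[exponential_law r0]_x g x
  = \int[mu]_x (g x * (exponential_pdf r x)%:E).
Proof.
move=> g0 mg; apply: ge0_integral_density => //.
- exact/exponential_pdf_ge0/ltW.
- exact: measurable_exponential_pdf.
Qed.

(** The step that replaces Lebesgue measure by the exponential law: a point
[x >= b] is written [b + c * s], and [e ^ s] compensates the exponential
density of the increment [s]. *)
Lemma ge0_integral_ray (b c : R) (g : RM -> \bar R) : (0 < c)%R ->
  (forall x, 0 <= g x) -> measurable_fun setT g ->
  \int[mu]_x (g x * (b <= x)%R%:R%:E)
  = \int[unit_exponential]_s (g (b + c * s)%R * (c * expR s)%:E).
Proof.
move=> c0 g0 mg.
have mray : measurable_fun setT (fun x : RM => (b <= x)%R%:R%:E : \bar R).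
  apply/measurable_EFinP.
  rewrite (_ : (fun _ => _) = \1_(`[b, +oo[%classic : set RM))//.
  by apply/funext => x; rewrite indicE mem_setE in_itv/= andbT.
have mgc : measurable_fun setT (fun s : RM => g (b + c * s)%R).
  exact: (measurableT_comp mg (measurable_affine b c)).
have mce : measurable_fun setT (fun s : RM => (c * expR s)%:E).
  by apply/measurable_EFinP; exact: measurable_funM.
rewrite (ge0_integral_affine b c0); last 2 first.
- by move=> x; rewrite mule_ge0// lee_fin.
- exact: emeasurable_funM.
rewrite ge0_integral_exponential//; last 2 first.
- by move=> s; rewrite mule_ge0// lee_fin mulr_ge0 ?expR_ge0// ltW.
- exact: emeasurable_funM.
rewrite -ge0_integralZl//; last 3 first.
- apply: emeasurable_funM => //.
  by apply: (measurableT_comp mray); exact: measurable_affine.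
- by move=> s _; rewrite mule_ge0// lee_fin.
- by rewrite lee_fin ltW.
apply: eq_integral => s _; rewrite lerDl pmulr_rge0//.
have [s0|s0] := leP 0%R s; last by rewrite lt0_exponential_pdf// !mule0.
rewrite exponential_pdfE// mule1 muleC -muleA -EFinM; congr (_ * _%:E).
by rewrite mul1r mulN1r expRN mulfK// gt_eqF// expR_gt0.
Qed.

Lemma ge0_integral_exponential_scale (lambda : R) (g : RM -> \bar R)
  (l0 : (0 < lambda)%R) (l0' : (0 < lambda^-1)%R) :
  (forall x, 0 <= g x) -> measurable_fun setT g ->
  \int[exponential_law l0']_x g x
  = \int[unit_exponential]_s g (lambda * s)%R.
Proof.
move=> g0 mg.
have mpdf : measurable_fun setT (fun x : RM => (lambda^-1 * expR (- lambda^-1 * x))%:E).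
  by apply/measurable_EFinP; do ! apply: measurable_funM => //; exact: measurableT_comp.
rewrite ge0_integral_exponential//.
transitivity (\int[mu]_x
    (g x * (lambda^-1 * expR (- lambda^-1 * x))%:E * (0 <= x)%R%:R%:E)).
  apply: eq_integral => x _; rewrite -muleA; congr (_ * _).
  have [x0|x0] := leP 0%R x; first by rewrite exponential_pdfE// mule1.
  by rewrite lt0_exponential_pdf// mule0.
rewrite (ge0_integral_ray 0 l0)//; last 2 first.
- move=> x; rewrite mule_ge0// lee_fin mulr_ge0 ?expR_ge0//.
  by rewrite invr_ge0 ltW.
- exact: emeasurable_funM.
apply: eq_integral => s _.
rewrite add0r -muleA -EFinM.
(* the density at [lambda * s] is [lambda^-1 * e ^ (- s)] *)
rewrite [X in _ * X%:E](_ : _ = 1%R) ?mule1//.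
rewrite mulNr mulKf ?gt_eqF// mulrACA mulVf ?gt_eqF//.
by rewrite mul1r -expRD addNr expR0.
Qed.

End one_dimension.

(** * Volume of the simplex *)

Section simplex_volume.
Local Open Scope ereal_scope.
Context {R : realType}.
Local Notation RM := (measurableTypeR R).
Local Notation mu := (@lebesgue_measure R).

(** The volume of an [n]-dimensional simplex of side [s].  It vanishes for a
negative side even when [n = 0], so that [volume 0 s] records whether the
constraint [0 <= s] holds. *)
Definition volume (n : nat) (s : R) : R := ((0 <= s)%R%:R * s ^+ n / n`!%:R)%R.

Lemma volume_ge0 n s : (0 <= volume n s)%R.
Proof.
rewrite /volume; have [s0|_] := leP 0%R s; last by rewrite !mul0r.
by rewrite mul1r divr_ge0// exprn_ge0.
Qed.

Lemma measurable_volume n : measurable_fun setT (volume n).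
Proof.
apply: measurable_funM => //; apply: measurable_funM; last exact: exprn_measurable.
rewrite (_ : (fun _ => _) = \1_(`[0, +oo[%classic : set RM))%R//.
by apply/funext => x; rewrite indicE mem_setE in_itv/= andbT.
Qed.

(** With [sorted] instead of [path b] the lowest point serves as the lower bound
of the others, hence measurability holds jointly in the lowest point and the
others, as Fubini requires. *)
Lemma measurable_sorted n (e : R) :
  measurable [set x : n.-tuple RM | sorted <=%R (rcons x e)].
Proof.
rewrite (_ : mkset _ = \bigcap_(i in [set i | (i < n)%N])
    [set x : n.-tuple RM | (nth e x i <= nth e x i.+1)%R]); last first.
  apply/seteqP; split => x /=.
    move=> /(sortedP e) + i /= ilt => /(_ i).
    by rewrite size_rcons size_tuple ltnS !nth_rcons_default; exact.
  move=> H; apply/(sortedP e) => i.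
  by rewrite size_rcons size_tuple ltnS !nth_rcons_default; exact: H.
apply: bigcap_measurableType => i _.
rewrite -[X in measurable X]setTI.
by apply: measurable_fun_le => //; exact: measurable_nth.
Qed.

Lemma measurable_path n (b e : R) :
  measurable [set x : n.-tuple RM | path <=%R b (rcons x e)].
Proof.
rewrite -[X in measurable X]setTI.
have m1 := @measurable_tconsr _ RM n b.
exact: (m1 measurableT _ (@measurable_sorted n.+1 e)).
Qed.

Lemma measurable_sorted_fun n (e : R) :
  measurable_fun setT (fun x : n.-tuple RM => (sorted <=%R (rcons x e))%:R%:E : \bar R).
Proof.
apply/measurable_EFinP.
rewrite (_ : (fun _ => _) = \1_[set x : n.-tuple RM | sorted <=%R (rcons x e)]).
  by apply: measurable_indic; exact: measurable_sorted.
by apply/funext => x; rewrite indicE mem_setE.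
Qed.

Lemma measurable_path_fun n (b e : R) :
  measurable_fun setT (fun x : n.-tuple RM => (path <=%R b (rcons x e))%:R%:E : \bar R).
Proof.
apply/measurable_EFinP.
rewrite (_ : (fun _ => _) = \1_[set x : n.-tuple RM | path <=%R b (rcons x e)]).
  by apply: measurable_indic; exact: measurable_path.
by apply/funext => x; rewrite indicE mem_setE.
Qed.

Lemma integral_volume n (b e : R) :
  \int[mu]_x ((volume n (e - x))%:E * (b <= x)%R%:R%:E) = (volume n.+1 (e - b))%:E.
Proof.
pose G : R -> R := (cst e - id)%R.
pose f (x : R) : R := ((e - x) ^+ n / n`!%:R)%R.
pose F (x : R) : R := (- n.+1`!%:R^-1 * (e - x) ^+ n.+1)%R.
have dF (x : R) : is_derive x (1%R : R) F (f x).
  have -> : F = (- n.+1`!%:R^-1 \*: (G ^+ n.+1))%R.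
    by apply/funext => y; rewrite /F /= exprfctE.
  apply: is_derive_eq; rewrite /f /G /= /GRing.scale/= sub0r factS natrM.
  by field; rewrite nat1r !pnatr_eq0 -lt0n fact_gt0.
have cf : continuous f.
  have -> : f = (n`!%:R^-1 \*: (G ^+ n))%R.
    by apply/funext => y; rewrite /f /= exprfctE mulrC.
  move=> x; apply/differentiable_continuous/derivable1_diffP.
  by apply: derivableZ; apply: derivableX; apply: derivableB.
transitivity (\int[mu]_(x in `[b, e]) (f x)%:E).
  rewrite [RHS]integral_mkcond; apply: eq_integral => x _.
  rewrite patchE mem_setE in_itv/= /volume subr_ge0 /f -EFinM.
  by case: (b <= x)%R; case: (x <= e)%R; rewrite ?(mul0r, mulr0, mul1r, mulr1).
have [be|eb|->] := ltgtP b e.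
- rewrite (@continuous_FTC2 _ f F)//.
  + rewrite /F /volume subrr subr_ge0 ltW//= expr0n/= mulr0 mul1r.
    by rewrite mulNr -EFinB sub0r opprK mulrC.
  + exact: continuous_subspaceT.
  + have cF : continuous F.
      by move=> x; apply/differentiable_continuous/derivable1_diffP.
    split => [x _| |] //.
    * exact/cvg_at_right_filter/cF.
    * exact/cvg_at_left_filter/cF.
  + by move=> x _; rewrite derive1E; apply: derive_val.
- rewrite set_itv_ge ?integral_set0; last by rewrite bnd_simp -ltNge.
  by rewrite /volume subr_ge0 leNgt eb/= !mul0r.
- by rewrite set_itv1 integral_set1 /volume subrr expr0n/= mulr0 mul0r.
Qed.

(** Chains from [b] to [e], sliced by their lowest point. *)
Lemma integral_path n (b e : R) :
  \int[mpower mu n]_x (path <=%R b (rcons x e))%:R%:E = (volume n (e - b))%:E.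
Proof.
elim: n b => [|n IH] b.
  rewrite ge0_integral_mpower0; [|by []|exact: measurable_path_fun].
  by rewrite /volume /= subr_ge0 andbT expr0 divr1 mulr1.
rewrite ge0_integral_mpowerS; [|by []|exact: measurable_path_fun].
rewrite -integral_volume; apply: eq_integral => x _.
rewrite -IH -ge0_integralZr//; last exact: measurable_path_fun.
apply: eq_integral => t _ /=.
by rewrite -EFinM -natrM mulnb andbC.
Qed.

End simplex_volume.

(** * The simplex in exponential increments *)

Section simplex_coordinates.
Local Open Scope ereal_scope.
Context {R : realType}.
Local Notation RM := (measurableTypeR R).
Local Notation mu := (@lebesgue_measure R).

(** The walk that starts at [b] and has increments [c * t_i]; the starting point
varies along the induction on the number of coordinates. *)
Definition position (b c : R) k (t : k.-tuple RM) : k.-tuple RM :=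
  [tuple b + c * tnth (partial_sums t) i | i < k]%R.

Definition tuple_sum k (t : k.-tuple RM) : R := (\sum_(i < k) tnth t i)%R.

Lemma position_tcons b c k (x : RM) (t : k.-tuple RM) :
  position b c (tcons (x, t))
  = tcons ((b + c * x)%R : RM, position (b + c * x) c t).
Proof.
apply: eq_from_tnth => i; rewrite !tnth_mktuple big_mkcond big_ord_recl /=.
case: (unliftP ord0 i) => [j|] ->.
  rewrite tnthS !tnth_mktuple [tnth _ ord0](_ : _ = x)//.
  rewrite [X in _ = (_ + c * X)%R]big_mkcond mulrDr addrA.
  by congr (_ + c * _)%R; apply: eq_bigr => l _; rewrite !lift0 tnthS.
by rewrite big1 ?addr0.
Qed.

Lemma tuple_sum_tcons k (x : RM) (t : k.-tuple RM) :
  tuple_sum (tcons (x, t)) = (x + tuple_sum t)%R.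
Proof.
rewrite /tuple_sum big_ord_recl; congr (_ + _)%R.
by apply: eq_bigr => i _; rewrite tnthS.
Qed.

Lemma measurable_tuple_sum k : measurable_fun setT (@tuple_sum k).
Proof. by apply: measurable_sum => i; exact: measurable_tnth. Qed.

Lemma measurable_partial_sums k :
  measurable_fun setT (@partial_sums R k).
Proof.
apply/measurable_fun_tnthP => i.
rewrite (_ : _ \o _ = fun t : k.-tuple RM =>
    \sum_(j < k) if (j <= i)%N then tnth t j else 0)%R; last first.
  by apply/funext => t /=; rewrite tnth_mktuple big_mkcond.
apply: (@measurable_sum _ _ _ _ _ _ (fun (j : 'I_k) (t : k.-tuple RM) =>
  if (j <= i)%N then tnth t j else 0%R)) => j.
by case: (j <= i)%N => //; exact: measurable_tnth.
Qed.

Lemma measurable_position b c k : measurable_fun setT (@position b c k).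
Proof.
apply/measurable_fun_tnthP => i.
rewrite (_ : _ \o _ = fun t : k.-tuple RM =>
    (b + c * tnth (partial_sums t) i)%R); last first.
  by apply/funext => t /=; rewrite tnth_mktuple.
apply: (measurableT_comp (measurable_affine b c)).
by move/measurable_fun_tnthP: (@measurable_partial_sums k); exact.
Qed.

Lemma measurable_first_coords n k :
  measurable_fun setT (@first_coords R n k).
Proof.
apply/measurable_fun_tnthP => i.
rewrite (_ : _ \o _ = fun t : n.-tuple RM => nth 0%R t i); last first.
  by apply/funext => t /=; rewrite tnth_mktuple.
exact: measurable_nth.
Qed.

Lemma first_coords_tcons n k (x : RM) (t : n.-tuple RM) :
  first_coords k.+1 (tcons (x, t)) = tcons (x, first_coords k t).
Proof.
apply: eq_from_tnth => i; rewrite tnth_mktuple.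
by case: (unliftP ord0 i) => [j|] -> //; rewrite tnthS tnth_mktuple.
Qed.

(** [c ^ k] is the Jacobian of the passage to increments, the exponential turns
Lebesgue measure into the exponential law, and the volume is that of the chains
from the [k]-th point up to [e]. *)
Definition chain_weight (b c e : R) n k (t : k.-tuple RM) : R :=
  (c ^+ k * expR (tuple_sum t) * volume (n - k) (e - b - c * tuple_sum t))%R.

Lemma chain_weight_ge0 b c e n k (t : k.-tuple RM) : (0 < c)%R ->
  (0 <= chain_weight b c e n t)%R.
Proof.
move=> c0; apply: mulr_ge0; last exact: volume_ge0.
by apply: mulr_ge0; [exact/exprn_ge0/ltW|exact: expR_ge0].
Qed.

Lemma measurable_chain_weight b c e n k :
  measurable_fun setT (@chain_weight b c e n k).
Proof.
apply: measurable_funM.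
  apply: measurable_funM => //.
  exact: measurableT_comp (@measurable_tuple_sum k).
apply: measurableT_comp; first exact: measurable_volume.
apply: measurable_funB => //; apply: measurable_funM => //.
exact: measurable_tuple_sum.
Qed.

Lemma chain_weight_tcons b c e n k (s : RM) (t : k.-tuple RM) :
  chain_weight b c e n.+1 (tcons (s, t))
  = (chain_weight (b + c * s) c e n t * (c * expR s))%R.
Proof.
rewrite /chain_weight tuple_sum_tcons subSS expRD exprS mulrDr !opprD !addrA.
by ring.
Qed.

(** The lowest point and the others are separated by Fubini; the induction
hypothesis is applied to the others with the lowest point as new lower bound,
and [ge0_integral_ray] converts the integral over the lowest point. *)
Lemma ge0_integral_chain (c e : R) n k (b : R) (h : k.-tuple RM -> \bar R) :
  (0 < c)%R -> (k <= n)%N ->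
  (forall x, 0 <= h x) -> measurable_fun setT h ->
  \int[mpower mu n]_x (h (first_coords k x) * (path <=%R b (rcons x e))%:R%:E)
  = \int[mpower unit_exponential k]_t
      (h (position b c t) * (chain_weight b c e n t)%:E).
Proof.
move=> c0 kn h0 mh; elim: k n b kn h h0 mh => [|k IH] n b kn h h0 mh.
  rewrite (ge0_integral_mpower0 unit_exponential); last 2 first.
  - by move=> x; rewrite mule_ge0// lee_fin chain_weight_ge0.
  - apply: emeasurable_funM; first exact: (measurableT_comp mh (@measurable_position _ _ _)).
    by apply/measurable_EFinP; exact: measurable_chain_weight.
  rewrite (tuple0 (position _ _ _)) /chain_weight /tuple_sum big_ord0.
  rewrite expR0 !mul1r subn0 mulr0 subr0 -integral_path -ge0_integralZl//; last first.
    exact: measurable_path_fun.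
  by apply: eq_integral => x _; rewrite (tuple0 (first_coords _ _)).
case: n kn => // n; rewrite ltnS => kn.
have mF : measurable_fun setT (fun x : n.+1.-tuple RM =>
    h (first_coords k.+1 x) * (path <=%R b (rcons x e))%:R%:E).
  apply: emeasurable_funM; last exact: measurable_path_fun.
  exact: (measurableT_comp mh (@measurable_first_coords _ _)).
have mS : measurable_fun setT (fun x : n.+1.-tuple RM =>
    h (first_coords k.+1 x) * (sorted <=%R (rcons x e))%:R%:E).
  apply: emeasurable_funM; last exact: measurable_sorted_fun.
  exact: (measurableT_comp mh (@measurable_first_coords _ _)).
rewrite (ge0_integral_mpowerS mu) => [|x|]; [|by rewrite mule_ge0|by[]].
transitivity (\int[mu]_x ((\int[mpower mu n]_t (h (first_coords k.+1 (tcons (x, t))) *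
     (sorted <=%R (rcons (tcons (x, t)) e))%:R%:E)) * (b <= x)%R%:R%:E)).
  apply: eq_integral => x _; rewrite -ge0_integralZr//; last 2 first.
  - exact: (measurableT_comp mS (@measurable_tconsr _ _ _ x)).
  - by move=> t _; rewrite mule_ge0.
  apply: eq_integral => t _ /=.
  by rewrite -muleA -EFinM -natrM mulnb andbC.
rewrite (ge0_integral_ray b c0); last 2 first.
- by move=> x; apply: integral_ge0 => t _; rewrite mule_ge0.
- apply: (@measurable_integral_tcons _ _ _ mu n _ _ mS).
  by move=> x; rewrite mule_ge0.
rewrite (ge0_integral_mpowerS unit_exponential); last 2 first.
- by move=> x; rewrite mule_ge0// lee_fin chain_weight_ge0.
- apply: emeasurable_funM; first exact: (measurableT_comp mh (@measurable_position _ _ _)).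
  by apply/measurable_EFinP; exact: measurable_chain_weight.
apply: eq_integral => s _.
under eq_integral do rewrite first_coords_tcons.
have mhs : measurable_fun setT
    (fun t : k.-tuple RM => h (tcons ((b + c * s)%R : RM, t))).
  exact: (measurableT_comp mh (@measurable_tconsr _ _ _ (b + c * s)%R)).
rewrite (IH n (b + c * s)%R kn (fun t => h (tcons ((b + c * s)%R : RM, t))))//.
rewrite -ge0_integralZr//; last 3 first.
- apply: emeasurable_funM.
    exact: (measurableT_comp mhs (@measurable_position _ _ _)).
  by apply/measurable_EFinP; exact: measurable_chain_weight.
- by move=> t _; rewrite mule_ge0// lee_fin chain_weight_ge0.
- by rewrite lee_fin mulr_ge0 ?expR_ge0// ltW.
apply: eq_integral => t _.
by rewrite -muleA -EFinM chain_weight_tcons position_tcons.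
Qed.

End simplex_coordinates.

(** * The law of the first coordinates *)

Section mnormalize.
Local Open Scope ereal_scope.
Context d (T : measurableType d) (R : realType).
Variables (m : {measure set T -> \bar R}) (P : probability T R).

Lemma mnormalizeE (v : R) (A : set T) : v != 0%R -> m setT = v%:E ->
  mnormalize m P A = v^-1%:E * m A.
Proof.
by move=> v0 mv; rewrite /mnormalize mv eqe (negbTE v0)/= muleC.
Qed.

Lemma mnormalize0E : m setT = 0 -> mnormalize m P = P.
Proof. by move=> m0; rewrite /mnormalize m0 eqxx. Qed.

End mnormalize.

Section simplex_law.
Local Open Scope ereal_scope.
Context {R : realType}.
Local Notation RM := (measurableTypeR R).
Local Notation mu := (@lebesgue_measure R).

Lemma mpower_simplex n (a : R) : mpower mu n (simplex n a) = (volume n a)%:E.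
Proof.
have -> : volume n a = volume n (a - 0) by rewrite subr0.
rewrite -(integral_path n 0) -[simplex n a]setIT -integral_indic//; last first.
  exact: measurable_simplex.
by apply: eq_integral => x _; rewrite indicE mem_setE.
Qed.

Lemma volume_gt0 n (a : R) : (0 < a)%R -> (0 < volume n a)%R.
Proof.
by move=> a0; rewrite /volume ltW// mul1r divr_gt0 ?exprn_gt0.
Qed.

Lemma ge0_integral_simplex_prob n (a : R) (h : n.-tuple RM -> \bar R) :
  (0 < a)%R -> (forall x, 0 <= h x) -> measurable_fun setT h ->
  \int[simplex_prob n a]_x h x
  = (volume n a)^-1%:E *
    \int[mpower mu n]_x (h x * (path <=%R 0%R (rcons x a))%:R%:E).
Proof.
move=> a0 h0 mh.
have V0 := volume_gt0 n a0.
pose p (x : n.-tuple RM) : R :=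
  ((volume n a)^-1 * (path <=%R 0%R (rcons x a))%:R)%R.
have mp : measurable_fun setT p.
  apply: measurable_funM => //; apply/measurable_EFinP.
  exact: measurable_path_fun.
rewrite (@ge0_integral_density _ _ _ (simplex_prob n a) (mpower mu n) p)//.
- rewrite -ge0_integralZl//.
  + by apply: eq_integral => x _; rewrite EFinM muleCA.
  + by apply: emeasurable_funM => //; exact: measurable_path_fun.
  + by move=> x _; rewrite mule_ge0.
  + by rewrite lee_fin invr_ge0 ltW.
- by move=> x; rewrite mulr_ge0// invr_ge0 ltW.
- move=> A mA.
  rewrite /= /simplex_prob /= (@mnormalizeE _ _ _ _ _ (volume n a)) ?gt_eqF//;
    last first.
    by rewrite /= /mrestr setTI mpower_simplex.
  rewrite /mrestr.
  under eq_integral do rewrite EFinM.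
  rewrite ge0_integralZl//; last 2 first.
  + by apply: measurable_funTS; exact: measurable_path_fun.
  + by rewrite lee_fin invr_ge0 ltW.
  rewrite -[LHS]/(_ * mpower mu n (A `&` simplex n a)) setIC.
  rewrite -integral_indic//; last exact: measurable_simplex.
  by congr (_ * _); apply: eq_integral => x _; rewrite indicE mem_setE.
Qed.

(** The density of the first [k] points of the simplex of side [n] with respect
to the exponential walk of mean 1, as a function of the [k]-th point. *)
Definition simplex_density n k (s : R) : R :=
  ((s <= n%:R)%R%:R * ((n ^_ k)%:R / n%:R ^+ k) * (1 - s / n%:R) ^+ (n - k)
   * expR s)%R.

Lemma measurable_simplex_density n k : measurable_fun setT (simplex_density n k).
Proof.
apply: measurable_funM; last exact: measurable_expR.
apply: measurable_funM; last first.
  by apply: measurable_funX; apply: measurable_funB => //; exact: measurable_funM.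
apply: measurable_funM => //.
rewrite (_ : (fun _ => _) = \1_(`]-oo, n%:R]%classic : set RM))%R//.
by apply/funext => x; rewrite indicE mem_setE in_itv.
Qed.

Lemma simplex_density_ge0 n k s : (0 <= simplex_density n k s)%R.
Proof.
rewrite /simplex_density; have [sn|_] := leP s n%:R; last by rewrite !mul0r.
apply: mulr_ge0; last exact: expR_ge0.
rewrite mul1r mulr_ge0// exprn_ge0// subr_ge0.
case: n sn => [|n sn]; first by rewrite invr0 mulr0 ler01.
by rewrite ler_pdivrMr// mul1r.
Qed.

Lemma simplex_densityE n k (c : R) (t : k.-tuple RM) : (k <= n)%N -> (0 < n)%N ->
  (0 < c)%R ->
  ((volume n (c * n%:R))^-1 * chain_weight 0 c (c * n%:R) n t
   = simplex_density n k (tuple_sum t))%R.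
Proof.
move=> kn n0 c0; set s := tuple_sum t.
have n0' : (n%:R != 0 :> R)%R by rewrite pnatr_eq0 -lt0n.
rewrite /chain_weight /volume subr0 -/s -mulrBr !pmulr_rge0// subr_ge0 /simplex_density.
rewrite ler0n mul1r.
have [sn|sn] := leP s n%:R; last by rewrite !mul0r !mulr0.
rewrite !mul1r -(ffact_fact kn) natrM.
have -> : (n%:R - s = n%:R * (1 - s / n%:R) :> R)%R by field.
have nE (x : R) : (x ^+ n = x ^+ k * x ^+ (n - k))%R by rewrite -exprD subnKC.
rewrite !exprMn (nE c) (nE n%:R).
have f0 m : (m`!%:R != 0 :> R)%R by rewrite pnatr_eq0 -lt0n fact_gt0.
have f1 : ((n ^_ k)%:R != 0 :> R)%R by rewrite pnatr_eq0 -lt0n ffact_gt0.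
have c1 : (c != 0)%R by rewrite gt_eqF.
by field; rewrite !expf_neq0// f0 f1.
Qed.

Lemma ge0_integral_simplex_law_pos n k (a : R) (h : k.-tuple RM -> \bar R) :
  (0 < a)%R -> (k <= n)%N -> (0 < n)%N ->
  (forall x, 0 <= h x) -> measurable_fun setT h ->
  \int[simplex_law n k a]_x h x
  = \int[mpower unit_exponential k]_t
      (h (position 0 (a / n%:R) t) * (simplex_density n k (tuple_sum t))%:E).
Proof.
move=> a0 kn n0 h0 mh.
have c0 : (0 < a / n%:R)%R by rewrite divr_gt0// ltr0n.
have aE : (a = a / n%:R * n%:R)%R by rewrite divfK// pnatr_eq0 -lt0n.
rewrite ge0_integral_pushforwardT//; last exact: measurable_first_coords.
rewrite ge0_integral_simplex_prob//; last first.
  exact: (measurableT_comp mh (@measurable_first_coords _ _ _)).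
rewrite (ge0_integral_chain a 0 c0 kn h0 mh) {1 4}aE.
rewrite -ge0_integralZl//; last 3 first.
- apply: emeasurable_funM.
    exact: (measurableT_comp mh (@measurable_position _ _ _ _)).
  by apply/measurable_EFinP; exact: measurable_chain_weight.
- by move=> t _; rewrite mule_ge0// lee_fin chain_weight_ge0.
- by rewrite lee_fin invr_ge0 volume_ge0.
apply: eq_integral => t _.
by rewrite muleCA -EFinM simplex_densityE.
Qed.

End simplex_law.

Section law_integrals.
Local Open Scope ereal_scope.
Context {R : realType}.
Local Notation RM := (measurableTypeR R).

Lemma position0 k (t : k.-tuple RM) : position 0 0 t = zero_tuple k.
Proof. by apply: eq_from_tnth => i; rewrite !tnth_mktuple mul0r addr0. Qed.

Lemma first_coords0 n k : first_coords k (zero_tuple n) = zero_tuple k :> k.-tuple RM.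
Proof.
apply: eq_from_tnth => i; rewrite !tnth_mktuple.
have [lt_in|le_ni] := ltnP i n; last by rewrite nth_default// size_tuple.
by rewrite (nth_map (Ordinal lt_in)) ?size_enum_ord.
Qed.

Lemma simplex_prob0 n : (0 < n)%N ->
  simplex_prob n (0 : R) = \d_(zero_tuple n) :> (set _ -> \bar R).
Proof.
move=> n0; apply: mnormalize0E.
rewrite -[LHS]/(mpower lebesgue_measure n (setT `&` simplex n 0)) setTI.
rewrite mpower_simplex /volume expr0n gtn_eqF//.
by rewrite mulr0 mul0r.
Qed.

(** The law of the first coordinates of the simplex of side 1 has mass 1. *)
Lemma integral_simplex_density n k : (k <= n)%N -> (0 < n)%N ->
  \int[mpower unit_exponential k]_t (simplex_density n k (tuple_sum t))%:E = 1 :> \bar R.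
Proof.
move=> kn n0.
transitivity (\int[simplex_law n k (1%R : R)]_x (cst 1 x : \bar R)).
  rewrite ge0_integral_simplex_law_pos//.
  by apply: eq_integral => t _; rewrite mul1e.
rewrite ge0_integral_pushforwardT//; last exact: measurable_first_coords.
by rewrite integral_cst// mul1e; exact: probability_setT.
Qed.

(** For [a = 0] both sides are [h] at the origin: the law is the unit mass
there, and on the right every position is 0 while the density integrates
to 1. *)
Lemma ge0_integral_simplex_law n k (a : R) (h : k.-tuple RM -> \bar R) :
  (0 <= a)%R -> (k <= n)%N -> (0 < n)%N ->
  (forall x, 0 <= h x) -> measurable_fun setT h ->
  \int[simplex_law n k a]_x h x
  = \int[mpower unit_exponential k]_t
      (h (position 0 (a / n%:R) t) * (simplex_density n k (tuple_sum t))%:E).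
Proof.
rewrite le_eqVlt => /predU1P[<-|a0] kn n0 h0 mh; last first.
  exact: ge0_integral_simplex_law_pos.
rewrite mul0r; under [RHS]eq_integral do rewrite position0.
rewrite ge0_integralZl//; last 2 first.
- apply/measurable_EFinP; apply: measurableT_comp; first exact: measurable_simplex_density.
  exact: measurable_tuple_sum.
- by move=> t _; rewrite lee_fin simplex_density_ge0.
rewrite integral_simplex_density// mule1.
rewrite ge0_integral_pushforwardT//; last exact: measurable_first_coords.
rewrite (eq_measure_integral (\d_(zero_tuple n))); last first.
  by move=> A mA _; exact: (congr1 (@^~ A) (simplex_prob0 n0)).
rewrite integral_dirac//; last first.
  exact: (measurableT_comp mh (@measurable_first_coords _ _ _)).
by rewrite diracT mul1e first_coords0.
Qed.

Lemma integral_simplex_law n k (a : R) (f : k.-tuple RM -> R) :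
  (0 <= a)%R -> (k <= n)%N -> (0 < n)%N -> measurable_fun setT f ->
  \int[simplex_law n k a]_x (f x)%:E
  = \int[mpower unit_exponential k]_t
      (f (position 0 (a / n%:R) t) * simplex_density n k (tuple_sum t))%:E.
Proof.
move=> a0 kn n0 mf.
pose m : {measure set (k.-tuple RM) -> \bar R} :=
  measure_function_pushforward__canonical__measure_function_Measure
    (simplex_prob n a) (@measurable_first_coords R n k).
under [RHS]eq_integral do rewrite EFinM.
rewrite -[LHS]/(\int[m]_x (f x)%:E).
rewrite (@integral_of_ge0 _ _ _ _ _ m (mpower unit_exponential k)
  (@position R 0 (a / n%:R) k) (fun t => simplex_density n k (tuple_sum t)) _ _ (EFin \o f)).
- by apply: eq_integral.
- by move=> t; exact: simplex_density_ge0.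
- by move=> h h0 mh; exact: ge0_integral_simplex_law.
- exact/measurable_EFinP.
Qed.

Lemma partial_sums_map c k (t : k.-tuple RM) :
  partial_sums (map_tuple (fun s : RM => c * s)%R t) = position 0 c t.
Proof.
apply: eq_from_tnth => i; rewrite !tnth_mktuple add0r mulr_sumr.
by apply: eq_bigr => j _; rewrite tnth_map.
Qed.

Lemma integral_exp_walk_law (lambda : R) k (f : k.-tuple RM -> R) :
  (0 < lambda)%R -> measurable_fun setT f ->
  \int[exp_walk_law lambda k]_x (f x)%:E
  = \int[mpower unit_exponential k]_t (f (position 0 lambda t))%:E.
Proof.
move=> l0 mf; have l0' : (0 < lambda^-1)%R by rewrite invr_gt0.
pose m : {measure set (k.-tuple RM) -> \bar R} :=
  measure_function_pushforward__canonical__measure_function_Measure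
    (mpower (exponential_law l0') k) (@measurable_partial_sums R k).
under [RHS]eq_integral do rewrite -[X in X%:E]mulr1 EFinM.
rewrite -[LHS]/(\int[m]_x (f x)%:E).
rewrite (@integral_of_ge0 _ _ _ _ _ m (mpower unit_exponential k)
  (@position R 0 lambda k) (cst 1%R) _ _ (EFin \o f)).
- by apply: eq_integral.
- by [].
- move=> h h0 mh.
  transitivity (\int[mpower (exponential_law l0') k]_t h (partial_sums t)).
    exact: (@ge0_integral_pushforwardT _ _ _ _ R (mpower (exponential_law l0') k)
      _ h (@measurable_partial_sums R k)).
  transitivity (\int[mpower unit_exponential k]_t
      h (partial_sums (map_tuple (fun s : RM => lambda * s)%R t))).
    apply: (@ge0_integral_mpower_map _ _ _ _ _ (exponential_law l0')
      unit_exponential (fun s : RM => lambda * s)%R k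
      (fun t => h (partial_sums t))).
    + exact: measurable_funM.
    + by move=> g g0 mg; exact: ge0_integral_exponential_scale.
    + by move=> t; exact: h0.
    + exact: (measurableT_comp mh (@measurable_partial_sums _ _)).
  by apply: eq_integral => t _; rewrite partial_sums_map mule1.
- exact/measurable_EFinP.
Qed.

End law_integrals.

(** * Bound and limit of the density *)

Section density_limit.
Context {R : realType}.

Lemma ffact_le_exp n k : (n ^_ k <= n ^ k)%N.
Proof.
elim: k => [|k IH]; first by rewrite ffactn0.
by rewrite ffactnSr expnSr leq_mul// leq_subr.
Qed.

(** The exponents add up to [s - s * (n - k) / n = s * k / n], and [s <= n]. *)
Lemma simplex_density_le n k (s : R) : (0 < k)%N -> simplex_density n k s <= expR k%:R.
Proof.
move=> k0; have [nk|kn] := ltnP n k.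
  by rewrite /simplex_density ffact_small// mul0r mulr0 !mul0r expR_ge0.
have n0 : (0 < n)%N by exact: leq_trans kn.
have n0' : (0 < n%:R :> R) by rewrite ltr0n.
rewrite /simplex_density; have [sn|_] := leP s n%:R; last by rewrite !mul0r expR_ge0.
rewrite mul1r.
have h1 : (n ^_ k)%:R / n%:R ^+ k <= 1 :> R.
  by rewrite ler_pdivrMr ?exprn_gt0// mul1r -natrX ler_nat ffact_le_exp.
have h0 : 0 <= 1 - s / n%:R by rewrite subr_ge0 ler_pdivrMr// mul1r.
have h2 : (1 - s / n%:R) ^+ (n - k) <= expR (- (s / n%:R) * (n - k)%:R).
  by rewrite expRM_natr lerXn2r ?nnegrE ?expR_ge0// expR_ge1Dx.
apply: (@le_trans _ _ (1 * expR (- (s / n%:R) * (n - k)%:R) * expR s)).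
  apply: ler_wpM2r; first exact: expR_ge0.
  by apply: ler_pM => //; rewrite ?divr_ge0 ?exprn_ge0.
rewrite mul1r -expRD ler_expR natrB//.
rewrite (_ : _ + s = s * (k%:R / n%:R)); last by field; rewrite gt_eqF.
by rewrite mulrCA ler_piMr// ler_pdivrMr// mul1r.
Qed.

Lemma cvg_inv_shift (c : R) : (n%:R - c)^-1 @[n --> \oo] --> (0 : R).
Proof.
apply/gtr0_cvgV0.
  near=> n; rewrite subr_gt0.
  near: n; exact: nbhs_infty_gtr.
apply/cvgryPge => A; near=> n; rewrite lerBrDr.
near: n; exact: nbhs_infty_ger.
Unshelve. all: by end_near. Qed.

Lemma ffact_ratio_cvg k : (n ^_ k)%:R / n%:R ^+ k @[n --> \oo] --> (1 : R).
Proof.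
elim: k => [|k IH].
  by under eq_fun do rewrite ffactn0 expr0 divr1; exact: cvg_cst.
have h : (n - k)%:R / n%:R @[n --> \oo] --> (1 : R).
  apply: (@cvg_trans _ ((1 - k%:R * (n%:R - 0)^-1 : R) @[n --> \oo])).
    apply: near_eq_cvg; near=> n.
    have kn : (k < n)%N by near: n; exact: nbhs_infty_gt.
    rewrite subr0 natrB 1?ltnW// mulrBl divff// pnatr_eq0 -lt0n.
    exact: leq_trans kn.
  rewrite (_ : nbhs (1 : R) = nbhs (1 - k%:R * 0 : R)); last first.
    by rewrite mulr0 subr0.
  apply: cvgB; first exact: cvg_cst.
  by apply: cvgMl_tmp; exact: cvg_inv_shift.
rewrite (_ : (fun n => _) = fun n : nat =>
    (n ^_ k)%:R / n%:R ^+ k * ((n - k)%:R / n%:R) : R); last first.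
  by apply/funext => n; rewrite ffactnSr natrM exprSr invfM mulrACA.
by have := cvgM IH h; rewrite mulr1; exact.
Unshelve. all: by end_near. Qed.

Lemma cvg_expR_inv (a c : R) : expR (a * (n%:R - c)^-1) @[n --> \oo] --> (1 : R).
Proof.
have h : a * (n%:R - c)^-1 @[n --> \oo] --> (0 : R).
  rewrite (_ : nbhs (0 : R) = nbhs (a * 0 : R)); last by rewrite mulr0.
  by apply: cvgMl_tmp; exact: cvg_inv_shift.
by have := continuous_cvg _ (@continuous_expR R 0) h; rewrite expR0; exact.
Qed.

(** Squeeze between exponentials:
[e ^ (- s / (n - s)) <= 1 - s / n <= e ^ (- s / n)], where the lower bound is
[1 + x <= e ^ x] at [x = s / (n - s)], inverted. *)
Lemma simplex_density_cvg k (s : R) : simplex_density n k s @[n --> \oo] --> (1 : R).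
Proof.
have e1 := cvg_expR_inv (s * (k%:R - s)) s.
have e2 := cvg_expR_inv (s * k%:R) 0.
have p : (1 - s / n%:R) ^+ (n - k) * expR s @[n --> \oo] --> (1 : R).
  apply: (squeeze_cvgr _ e1 e2); near=> n.
  have kn : (k < n)%N by near: n; exact: nbhs_infty_gt.
  have sn : s < n%:R by near: n; exact: nbhs_infty_gtr.
  have n0 : 0 < n%:R :> R by rewrite ltr0n (leq_trans _ kn).
  have d0 : 0 < n%:R - s by rewrite subr_gt0.
  have q0 : 0 < 1 - s / n%:R by rewrite subr_gt0 ltr_pdivrMr// mul1r.
  apply/andP; split.
    rewrite -ler_pdivrMr ?expR_gt0// -expRN -expRD.
    rewrite (_ : _ - s = - (s / (n%:R - s)) * (n - k)%:R); last first.
      by rewrite natrB 1?ltnW//; field; rewrite gt_eqF.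
    rewrite expRM_natr lerXn2r ?nnegrE ?expR_ge0 ?(ltW q0)//.
    rewrite expRN -[leRHS]invrK lef_pV2 ?posrE ?invr_gt0 ?expR_gt0//.
    rewrite (_ : _^-1 = 1 + s / (n%:R - s)) ?expR_ge1Dx//.
    by field; rewrite !gt_eqF.
  rewrite -ler_pdivlMr ?expR_gt0// -expRN -expRD subr0.
  rewrite (_ : _ - s = - (s / n%:R) * (n - k)%:R); last first.
    by rewrite natrB 1?ltnW//; field; rewrite gt_eqF.
  by rewrite expRM_natr lerXn2r ?nnegrE ?expR_ge0 ?(ltW q0)// expR_ge1Dx.
apply: (@cvg_trans _ (((n ^_ k)%:R / n%:R ^+ k *
    ((1 - s / n%:R) ^+ (n - k) * expR s) : R) @[n --> \oo])).
  apply: near_eq_cvg; near=> n.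
  have sn : s < n%:R by near: n; exact: nbhs_infty_gtr.
  by rewrite /simplex_density (ltW sn) mul1r mulrA.
by have := cvgM (ffact_ratio_cvg k) p; rewrite mulr1; exact.
Unshelve. all: by end_near. Qed.

End density_limit.

(** * Measurability of continuous functions of a row vector *)

Section row_measurable.
Context {R : realType}.
Local Notation RM := (measurableTypeR R).

Definition grid (m : nat) (z : int) : R := z%:~R / m.+1%:R.

Lemma grid_floor (m : nat) (x : R) :
  `|x - grid m (Num.floor (x * m.+1%:R))| <= m.+1%:R^-1.
Proof.
have m0 : 0 < m.+1%:R :> R by [].
have /andP[lo hi] := floor_itv (x * m.+1%:R).
rewrite -[x in x - _](mulfK (lt0r_neq0 m0)) /grid -mulrBl normrM.
rewrite [X in _ * X]ger0_norm ?invr_ge0// ler_piMl ?invr_ge0//.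
rewrite ger0_norm ?subr_ge0// lerBlDl ltW//.
by rewrite intrD in hi.
Qed.

(** [f] is the pointwise limit of its compositions with the rounding of all
coordinates to multiples of [1 / m.+1], and such a composition is measurable
because it factors through the countable type of integer tuples. *)
Lemma measurable_continuous_row k (f : 'rV[R]_k -> R) : continuous f ->
  measurable_fun setT (fun t : k.-tuple RM => f (row_of t)).
Proof.
move=> cf.
pose z m (t : k.-tuple RM) : k.-tuple int :=
  map_tuple (fun x : R => Num.floor (x * m.+1%:R)) t.
pose G m (s : k.-tuple int) : 'rV[R]_k := \row_i grid m (tnth s i).
apply: (@measurable_fun_cvg _ _ _ _ (fun m t => f (G m (z m t)))).
  move=> m _ B mB; rewrite setTI.
  rewrite (_ : _ @^-1` B = \bigcup_(s : k.-tuple int)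
      ([set t | z m t = s] `&` [set t | B (f (G m s))])); last first.
    apply/seteqP; split => [t Bt|t [s _ [/= <-]]] //.
    by exists (z m t).
  apply: countable_bigcupT_measurable => // s.
  apply: measurableI; last first.
    have [Bs|nBs] := pselect (B (f (G m s))).
      by rewrite (_ : [set _ | _] = setT)//; apply/seteqP; split.
    by rewrite (_ : [set _ | _] = set0)//; apply/seteqP; split.
  rewrite (_ : [set t | _] = \bigcap_(i in [set: 'I_k])
      [set t : k.-tuple RM | Num.floor (tnth t i * m.+1%:R) = tnth s i]); last first.
    apply/seteqP; split => [t /= <- i _ /=|t H]; first by rewrite tnth_map.
    by apply: eq_from_tnth => i; rewrite tnth_map; exact: H.
  apply: fin_bigcap_measurable => [|i _]; first exact: finite_finset.
  rewrite -[X in measurable X]setTI.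
  have mi : measurable_fun setT (fun t : k.-tuple RM => tnth t i * m.+1%:R).
    by apply: measurable_funM => //; exact: measurable_tnth.
  rewrite (_ : [set _ | _] = (fun t : k.-tuple RM => tnth t i * m.+1%:R) @^-1`
      `[(tnth s i)%:~R, (tnth s i + 1)%:~R[%classic); last first.
    apply/seteqP; split => t /=; rewrite in_itv/=.
      by move=> <-; exact: floor_itv.
    by move=> H; exact: floor_def.
  exact: mi.
move=> t _; apply: (continuous_cvg _ (cf _)).
apply/cvg_ballP => e e0.
near=> m; split => // i j; rewrite !mxE /ball/=.
rewrite tnth_map.
apply: le_lt_trans (grid_floor _ _) _.
near: m; have := @cvg_harmonic R.
move=> /cvgrPdist_lt /(_ e e0); apply: filterS => m.
by rewrite sub0r normrN ger0_norm// /harmonic invr_ge0.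
Unshelve. all: by end_near. Qed.

Lemma row_of_position c k (t : k.-tuple RM) :
  row_of (position 0 c t) = c *: row_of (partial_sums t).
Proof. by apply/rowP => i; rewrite !mxE tnth_mktuple add0r. Qed.

End row_measurable.

(** * Passage to the limit *)

Section law_limit.
Context {R : realType}.
Local Notation RM := (measurableTypeR R).
Local Notation Pk k := (mpower (@unit_exponential R) k).

(** Dominated convergence against the exponential walk of mean 1, with the
constant bound [M * e ^ k]. *)
Lemma simplex_law_cvg k (a : nat -> R) (f : 'rV[R]_k -> R) (g : k.-tuple RM -> R)
    (M : R) :
  (0 < k)%N -> (forall n, 0 <= a n) -> continuous f -> (forall x, `|f x| <= M) ->
  measurable_fun setT g ->
  {ae Pk k, forall t, f ((a n / n%:R) *: row_of (partial_sums t)) @[n --> \oo]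
    --> g t} ->
  (\int[simplex_law n k (a n)]_x (f (row_of x))%:E @[n --> \oo]
   --> \int[Pk k]_t (g t)%:E)%E.
Proof.
move=> k0 a0 cf fM mg fg.
pose F n (t : k.-tuple RM) : \bar R :=
  (f (row_of (position 0 (a n / n%:R) t)) * simplex_density n k (tuple_sum t))%:E.
have mfr : measurable_fun setT (fun t : k.-tuple RM => f (row_of t)).
  exact: measurable_continuous_row.
apply: (@cvg_trans _ ((\int[Pk k]_t F n t)%E @[n --> \oo])).
  (* the formula for the law needs [k <= n], hence only holds eventually *)
  apply: near_eq_cvg; near=> n.
  have kn : (k < n)%N by near: n; exact: nbhs_infty_gt.
  rewrite /F (@integral_simplex_law R n k (a n) (fun x => f (row_of x)))//.
    exact: ltnW.
  exact: leq_trans kn.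
have [] := @dominated_convergence _ _ _ (Pk k) setT measurableT F (EFin \o g)
  (cst (M * expR k%:R)%:E) => //.
- move=> n; apply/measurable_EFinP; apply: measurable_funM.
    exact: (measurableT_comp mfr (@measurable_position _ _ _ _)).
  apply: measurableT_comp; first exact: measurable_simplex_density.
  exact: measurable_tuple_sum.
- exact/measurable_EFinP.
- apply: filterS fg => t fgt _; apply: cvg_EFin; first exact: nearW.
  rewrite -[X in _ --> X]mulr1; apply: cvgM; last exact: simplex_density_cvg.
  by under eq_fun do rewrite row_of_position.
- apply/integrableP; split => //.
  rewrite integral_cst//= [X in (_ * X)%E](probability_setT (Pk k)) mule1.
  by rewrite ltry.
- apply: aeW => t n _; rewrite /F lee_fin normrM ler_pM//.
  by rewrite ger0_norm ?simplex_density_ge0// simplex_density_le.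
Unshelve. all: by end_near. Qed.

Lemma exponential_power_null k :
  Pk k.+1 [set t | tnth t ord0 = 0] = 0%E.
Proof.
have := mcons_box (@unit_exponential R) (Pk k) (measurable_set1 (0 : R))
  (@measurableT _ (k.-tuple RM)).
rewrite [X in (X * _)%E](_ : _ = 0%E) ?mul0e; last first.
  by rewrite /= /exponential_prob integral_set1.
move=> <-; congr (_ _); apply/seteqP; split => t //=.
by case.
Qed.

Lemma compactly_supported_bound k (f : 'rV[R]_k -> R) :
  continuous f -> compactly_supported f ->
  exists2 M, (forall x, `|f x| <= M) &
    forall (x : 'rV[R]_k) i, M < `|x ord0 i| -> f x = 0.
Proof.
rewrite /compactly_supported => cf; set K := closure _ => cK.
have fK x : f x != 0 -> K x by move=> fx; exact: subset_closure.
have [M0 [_ HM0]] := compact_bounded cK.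
have /compact_bounded[M1 [_ HM1]] : compact (f @` K).
  by apply: continuous_compact => //; exact: continuous_subspaceT.
pose M := Num.max 0 (Num.max M0 M1) + 1.
have ltM : Num.max 0 (Num.max M0 M1) < M by rewrite ltrDl.
exists M => [x|x i].
  have [->|/fK Kx] := eqVneq (f x) 0.
    by rewrite normr0 (le_trans _ (ltW ltM))// le_max lexx.
  by apply: (HM1 M) => /=; [rewrite (le_lt_trans _ ltM)// !le_max lexx !orbT|exists x].
apply: contraPeq => /fK Kx; apply/negP; rewrite -leNgt.
apply: (@le_trans _ _ `|x|); last first.
  by apply: (HM0 M) => //; rewrite (le_lt_trans _ ltM)// !le_max lexx !orbT.
rewrite [leRHS]mx_normE -[leLHS]nngE num_le.
exact: (le_bigmax _ _ (ord0, i)).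
Qed.

Lemma bounded_fun_ubound k (f : 'rV[R]_k -> R) : bounded_fun f ->
  exists M, forall x, `|f x| <= M.
Proof. by move=> [M0 [_ HM]]; exists (M0 + 1) => x; apply: HM => //; rewrite ltrDl. Qed.

Lemma weak_cvg_scaled k (a : nat -> R) (c : R) (f : 'rV[R]_k -> R) :
  (0 < k)%N -> (forall n, 0 <= a n) -> a n / n%:R @[n --> \oo] --> c ->
  continuous f -> bounded_fun f ->
  (\int[simplex_law n k (a n)]_x (f (row_of x))%:E @[n --> \oo]
   --> \int[Pk k]_t (f (row_of (position 0 c t)))%:E)%E.
Proof.
move=> k0 a0 ac cf /bounded_fun_ubound[M fM].
apply: (@simplex_law_cvg _ _ _ (fun t => f (row_of (position 0 c t))) M) => //.
  exact: (measurableT_comp (measurable_continuous_row cf) (@measurable_position _ _ _ _)).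
apply: aeW => t; rewrite row_of_position.
by apply: (continuous_cvg _ (cf _)); exact: cvgZr_tmp.
Qed.

Lemma littleo_ratio_cvg (a : nat -> R) (c : R) :
  (forall eps, 0 < eps ->
    \forall n \near \oo, `|a n - c * n%:R| <= eps * `|n%:R : R|) ->
  a n / n%:R @[n --> \oo] --> c.
Proof.
move=> H; apply/cvgrPdist_le => eps eps0; near=> n.
have n0 : 0 < n%:R :> R by rewrite ltr0n; near: n; exact: nbhs_infty_gt.
rewrite distrC -[c](mulfK (lt0r_neq0 n0)) -mulrBl normrM normfV.
rewrite ler_pdivrMr ?normr_gt0 ?gt_eqF//.
by near: n; exact: H.
Unshelve. all: by end_near. Qed.

Lemma partial_sums_head k (t : k.+1.-tuple RM) :
  tnth (partial_sums t) ord0 = tnth t ord0.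
Proof.
rewrite tnth_mktuple (bigD1 ord0)//= big1 ?addr0// => i /andP[].
by rewrite leqn0 => /eqP i0 /eqP[]; exact: val_inj.
Qed.

End law_limit.

Theorem theorem3 (R : realType) (a : nat -> R) (ha : forall n, 0 <= a n) :
  (forall lambda : R, 0 < lambda ->
     a = (fun n => lambda * n%:R) +o_\oo (fun n => n%:R : R) ->
     forall k : nat, (0 < k)%N ->
       weak_cvg (fun n => simplex_law n k (a n)) (exp_walk_law lambda k)) /\
  (a =o_\oo (fun n => n%:R : R) ->
     forall k : nat, (0 < k)%N ->
       weak_cvg (fun n => simplex_law n k (a n)) \d_(zero_tuple k)) /\
  (a n / n%:R @[n --> \oo] --> +oo ->
     forall k : nat, (0 < k)%N ->
       vague_cvg0 (fun n => simplex_law n k (a n))).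
Proof.
split=> [lambda l0 al k k0 f cf bf|]; last split=> [al k k0 f cf bf|al k k0 f cf csf].
- rewrite integral_exp_walk_law//; last exact: measurable_continuous_row.
  apply: weak_cvg_scaled => //; apply: littleo_ratio_cvg => eps eps0.
  by move/eqaddoP : al => /(_ eps eps0).
- rewrite integral_dirac//; last first.
    by apply/measurable_EFinP; exact: measurable_continuous_row.
  rewrite diracT mul1e.
  have := @weak_cvg_scaled R k a 0 f k0 ha _ cf bf.
  under eq_integral do rewrite position0.
  rewrite integral_cst// [X in (_ * X)%E]probability_setT mule1; apply.
  apply: littleo_ratio_cvg => eps eps0; move/eqoP : al => /(_ eps eps0).
  by apply: filterS => n; rewrite mul0r subr0.
- case: k k0 f cf csf => // k _ f cf csf.
  have [M fM f0] := compactly_supported_bound cf csf.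
  rewrite -[X in _ --> X](integral0 (mpower (@unit_exponential R) k.+1) setT).
  apply: (@simplex_law_cvg _ _ _ _ (cst 0) M) => //.
  exists [set t | tnth t ord0 = 0]; split.
  + rewrite -[X in measurable X]setTI.
    exact: (@measurable_tnth _ (measurableTypeR R) _ ord0 measurableT _ (measurable_set1 (0 : R))).
  + exact: exponential_power_null.
  + (* if [t_0 != 0] then [c_n * t_0] leaves every bounded set *)
    move=> t /=; apply: contra_notP => /eqP t0.
    apply: (@cvg_trans _ ((fun _ : nat => 0 : R) @ \oo)); last exact: cvg_cst.
    apply: near_eq_cvg; near=> n; apply/esym/(f0 _ ord0).
    rewrite !mxE partial_sums_head normrM.
    apply: lt_le_trans (ler_wpM2r _ (ler_norm _)) => //.
    rewrite -ltr_pdivrMr ?normr_gt0//.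
    by near: n; move/cvgryPgt : al; exact.
Unshelve. all: by end_near. Qed.
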